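(* Let $q\geq 2$ be a prime power and let $n\geq 1$. Then $$\frac{\omega(\mathrm{GL}_n(q))}{|\mathrm{GL}_n(q)|}\geq\frac{N_n(q)}{|\mathrm{GL}_n(q)|}\geq q^{-n}\left(1-q^{-3}-q^{-5}+q^{-6}-q^{-n}\right),$$ where $\omega(\mathrm{GL}_n(q))$ is the maximum cardinality of a pairwise non-commuting subset of $\mathrm{GL}_n(q)$ and $N_n(q)$ is the number of distinct subgroups of $\mathrm{GL}_n(q)$ that are centralisers in $\mathrm{GL}_n(q)$ of cyclic matrices of $\mathrm{GL}_n(q)$.
   Context: $\mathrm{GL}_n(q)$ is the group of invertible $n\times n$ matrices over the field with $q$ elements. A subset $X$ of a group is pairwise non-commuting if $xy\neq yx$ for all distinct $x,y\in X$. An element $g\in\mathrm{GL}_n(q)$ is cyclic if its characteristic polynomial equals its minimal polynomial. Thus $N_n(q)=|\mathcal{N}_n(q)|$ where $\mathcal{N}_n(q)=\{C_{\mathrm{GL}_n(q)}(g)\mid g\text{ cyclic in }\mathrm{GL}_n(q)\}$. *)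

(* Defs.v *)
From HB Require Import structures.
From mathcomp Require Import all_boot all_order all_algebra all_fingroup.

Set Implicit Arguments.
Unset Strict Implicit.
Unset Printing Implicit Defensive.

Import GroupScope.

Definition pairwise_noncommuting (gT : finGroupType) (X : {set gT}) : bool :=
  [forall x in X, forall y in X, (x != y) ==> (x * y != y * x)].

Definition omega (gT : finGroupType) (G : {set gT}) : nat :=
  \max_(X : {set gT} | (X \subset G) && pairwise_noncommuting X) #|X|.

(* {'GL_n[F]} is the group of units of 'M[F]_n.-1.+1, so it is the usual
   general linear group only for 0 < n. *)
Definition cyclic_mx (F : finFieldType) (n : nat) (g : {'GL_n[F]}) : bool :=
  char_poly (GLval g) == mxminpoly (GLval g).

Definition cyclic_centralisers (F : finFieldType) (n : nat) :
    {set {set {'GL_n[F]}}} :=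
  [set 'C_('GL_n[F])[g] | g in 'GL_n[F] & cyclic_mx g].

(* Main.v *)
Require Import Defs.
From HB Require Import structures.
From mathcomp Require Import all_boot all_order all_algebra all_fingroup.
From mathcomp Require Import ring lra zify.

Set Implicit Arguments.
Unset Strict Implicit.
Unset Printing Implicit Defensive.

Import Order.TTheory GRing.Theory Num.Theory.
Local Open Scope ring_scope.

(** The argument proves the bound [N / |GL_n(q)| >= q^-n], which is stronger
    because [q^-6 <= q^-5] makes the last factor at most [1].

    A matrix [g] whose minimal polynomial [mu] has degree [n] has a cyclic
    vector, so every matrix commuting with [g] is a polynomial in [g]
    ([comm_mx_horner_cyclic]). Hence the centraliser of a cyclic [g] is abelian,
    and two commuting cyclic elements have the same centraliser. Choosing one
    cyclic element for each centraliser of a cyclic element therefore gives a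
    pairwise non-commuting set, which is the first inequality
    ([card_cyclic_centralisers_le_omega]).

    For the second one, an element [h] with [C(h) = C] lies in [C], so each
    centraliser [C] is produced by at most [|C|] cyclic elements, and
    [N >= \sum_g 1 / |C(g)|] over the cyclic [g] ([sum_inv_cent_le]). Sort the
    cyclic elements by their minimal polynomial [f], a monic polynomial of
    degree [n] with [f(0) <> 0]. Every such [f] occurs (companion matrices), and
    the conjugacy class of a [g_f] with minimal polynomial [f] has
    [|GL_n(q)| / |C(g_f)|] elements, so that
    [N / |GL_n(q)| >= \sum_f 1 / |C(g_f)|^2].

    If [f] has [k] roots in the field, an element of [C(g_f)] is [h(g_f)] with
    [h] of degree less than [n] and not vanishing at these roots, so [C(g_f)]
    has at most [q^(n-k) (q-1)^k] elements ([card_cyclic_cent]). Bernoulli's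
    inequality then gives [1 / |C(g_f)|^2 >= q^(-2n) (1 + 2k/(q-1))] ([inv_sqr_ge]). Let [P_n]
    be the set of the polynomials [f]. The pairs [(f, a)] with [a] a root of [f]
    number at least [(q-1) |P_(n-1)|], because [(a, u)] maps to
    [((X - a) u, a)] for [a <> 0] and [u] in [P_(n-1)] ([sum_card_rootset]).
    Therefore [N / |GL_n(q)| >= q^(-2n) (|P_n| + 2 |P_(n-1)|)], and the sum in
    parentheses is at least [q^n] by a direct count. *)

(** * Cyclic vectors and centralisers of cyclic matrices *)

Lemma irreducible_factor (K : finFieldType) (d : {poly K}) :
  (1 < size d)%N -> exists2 p : {poly K}, irreducible_poly p & p %| d.
Proof.
have [m] := ubnP (size d); elim: m d => // m IHm d le_d_m d_gt1.
have d0 : d != 0 by rewrite -size_poly_gt0 ltnW.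
have [irr_d | ] := boolP (irreducibleb d).
  by exists d; [apply/irreducibleP | exact: dvdpp].
rewrite /irreducibleb d_gt1 /= => /forallPn[q].
rewrite negb_imply -ltnNge => /andP[q_d q_gt1].
have q_lt : (size q < size d)%N.
  by rewrite (leq_ltn_trans (size_npoly q)) // ltn_predL ltnW.
have [|p irr_p p_q] := IHm q _ q_gt1; first exact: leq_trans q_lt _.
by exists p => //; apply: dvdp_trans p_q _; rewrite Pdiv.Idomain.dvdpE.
Qed.

Lemma exact_power_factor (K : fieldType) (p d : {poly K}) :
  (1 < size p)%N -> d != 0 ->
  exists k (c : {poly K}), d = p ^+ k * c /\ ~~ (p %| c).
Proof.
move=> p_gt1; have [m] := ubnP (size d); elim: m d => // m IHm d le_d_m d0.
have [/dvdpP[c def_d] | p'd] := boolP (p %| d); last first.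
  by exists 0%N, d; rewrite expr0 mul1r.
have c0 : c != 0 by apply: contra_neq d0 => c0; rewrite def_d c0 mul0r.
have p0 : p != 0 by rewrite -size_poly_gt0 ltnW.
have [|k [e [def_c p'e]]] := IHm c _ c0.
  rewrite -ltnS (leq_trans _ le_d_m) // def_d size_mul // ltnS.
  by move: p_gt1; case: (size p) => [|[|s]] // _; rewrite !addnS ltnS leq_addr.
by exists k.+1, e; rewrite exprSr -mulrA (mulrC p) mulrA -def_c.
Qed.

Section PrimaryVector.

Variables (K : fieldType) (n : nat) (A : 'M[K]_n.+1).
Local Notation mu := (mxminpoly A).

Lemma mulmx_horner_dvdp (v : 'rV_n.+1) (d h : {poly K}) :
  v *m horner_mx A d = 0 -> d %| h -> v *m horner_mx A h = 0.
Proof.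
by move=> vd0 /dvdpP[e ->]; rewrite mulrC rmorphM mulmxA vd0 mul0mx.
Qed.

(** Some [w] is not killed by [mu / p], and [w * e(A)] then has annihilator
    exactly [p ^+ k.+1]. *)
Lemma primary_vector (p e : {poly K}) k :
    irreducible_poly p -> mu = p ^+ k.+1 * e ->
  exists2 u : 'rV_n.+1, u *m horner_mx A (p ^+ k.+1) = 0
    & forall h, u *m horner_mx A h = 0 -> p ^+ k.+1 %| h.
Proof.
move=> irr_p def_mu; pose m := p ^+ k * e.
have p0 := irredp_neq0 irr_p.
have mu0 : mu != 0 by rewrite monic_neq0 ?mxminpoly_monic.
have m_nz : horner_mx A m != 0.
  rewrite -dvd_mxminpoly; apply: contraL isT => /dvdp_leq.
  have m0 : m != 0.
    by apply: contra_neq mu0 => m0; rewrite def_mu exprS -mulrA -/m m0 mulr0.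
  move/(_ m0); rewrite def_mu exprS -mulrA -/m size_mul //.
  have [+ _] := irr_p; case: (size p) => [|[|s]] // _.
  by rewrite addSn /= addSn ltnNge leq_addl.
have [i row_i] : exists i, row i (horner_mx A m) != 0.
  apply/existsP; apply: contraR m_nz => /existsPn no_row.
  by apply/eqP/row_matrixP=> i; rewrite row0; apply/eqP; rewrite -[_ == _]negbK.
pose u : 'rV_n.+1 := delta_mx 0 i *m horner_mx A e.
have uE h : u *m horner_mx A h = delta_mx 0 i *m horner_mx A (e * h).
  by rewrite rmorphM mulmxA.
have u_pk1 : u *m horner_mx A (p ^+ k.+1) = 0.
  by rewrite uE mulrC -def_mu mx_root_minpoly mulmx0.
have u_pk : u *m horner_mx A (p ^+ k) != 0 by rewrite uE mulrC -rowE.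
exists u => // h uh0.
suffices: forall j, (j <= k.+1)%N -> p ^+ j %| h by apply.
elim=> [|j IHj] lt_j_k; first by rewrite expr0 dvd1p.
have /dvdpP[h1 def_h] := IHj (ltnW lt_j_k).
rewrite def_h exprS dvdp_mul2r ?expf_neq0 //.
(* If [p] did not divide [h1], Bezout would express [p ^+ k] as a combination
   of [h] and [p ^+ k.+1], which both kill [u]. *)
apply: contraR u_pk; rewrite -irreducible_poly_coprime //.
case/Bezout_eq1_coprimepP=> -[s t] /= st1.
have -> : p ^+ k = t * p ^+ (k - j) * h + s * p ^+ k.+1.
  rewrite def_h exprS -{1 3}(subnK (lt_j_k : (j <= k)%N)) exprD.
  rewrite -[LHS]mulr1 -st1; ring.
apply/eqP.
rewrite rmorphD mulmxDr (mulmx_horner_dvdp uh0) ?dvdp_mull //.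
by rewrite (mulmx_horner_dvdp u_pk1) ?dvdp_mull // addr0.
Qed.

End PrimaryVector.

Section CyclicVector.

Variables (K : finFieldType) (n : nat) (A : 'M[K]_n.+1).
Local Notation mu := (mxminpoly A).

(** The exact annihilators of two vectors multiply when they are coprime and the
    vectors are added, so the primary vectors assemble along the factorisation
    of [d]. *)
Lemma coprime_factor_vector (d e : {poly K}) :
    mu = d * e -> coprimep d e ->
  exists2 v : 'rV_n.+1, v *m horner_mx A d = 0
    & forall h, v *m horner_mx A h = 0 -> d %| h.
Proof.
have mu0 : mu != 0 by rewrite monic_neq0 ?mxminpoly_monic.
have [m] := ubnP (size d); elim: m d e => // m IHm d e le_d_m def_mu co_d_e.
have d0 : d != 0 by apply: contra_neq mu0 => d0; rewrite def_mu d0 mul0r.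
have [d_le1 | d_gt1] := leqP (size d) 1.
  exists 0; first by rewrite mul0mx.
  move=> h _; rewrite (eqp_dvdl _ (_ : d %= 1)) ?dvd1p // -size_poly_eq1.
  by rewrite eqn_leq d_le1 size_poly_gt0.
have [p irr_p p_d] := irreducible_factor d_gt1.
have [p_gt1 _] := irr_p.
have [[|k] [c [def_d p'c]]] := exact_power_factor p_gt1 d0.
  by rewrite def_d expr0 mul1r (negPf p'c) in p_d.
have co_p_c : coprimep (p ^+ k.+1) c.
  by rewrite coprimep_expl // irreducible_poly_coprime.
move: co_d_e; rewrite def_d coprimepMl => /andP[co_p_e co_c_e].
have pk0 : p ^+ k.+1 != 0 by rewrite expf_neq0 ?irredp_neq0.
have c0 : c != 0 by apply: contra_neq d0 => c0; rewrite def_d c0 mulr0.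
have [|u u_p u_min] := @primary_vector K n A p (c * e) k irr_p.
  by rewrite def_mu def_d mulrA.
have [|||v v_c v_min] := IHm c (p ^+ k.+1 * e).
- rewrite -ltnS (leq_trans _ le_d_m) // ltnS def_d size_mul //.
  have: (1 < size (p ^+ k.+1))%N.
    by rewrite (leq_trans p_gt1) // dvdp_leq // exprS dvdp_mulr.
  case: (size (p ^+ _)) => [|[|s]] // _.
  by rewrite addSn /= addSn ltnS leq_addl.
- by rewrite def_mu def_d; ring.
- by rewrite coprimepMr co_c_e coprimep_sym co_p_c.
exists (u + v) => [|h].
  rewrite mulmxDl (mulmx_horner_dvdp u_p) ?dvdp_mulr //.
  by rewrite (mulmx_horner_dvdp v_c) ?dvdp_mull // addr0.
rewrite mulmxDl => uvh0; rewrite Gauss_dvdp //; apply/andP; split.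
  (* [c(A)] kills [v], and [p(A) ^+ k.+1] kills [u]. *)
  rewrite -(Gauss_dvdpl h co_p_c); apply: u_min.
  have : (u *m horner_mx A h + v *m horner_mx A h) *m horner_mx A c = 0.
    by rewrite uvh0 mul0mx.
  rewrite mulmxDl -!mulmxA !mulmxE -!rmorphM.
  by rewrite (mulmx_horner_dvdp v_c) ?dvdp_mull // addr0.
rewrite -(Gauss_dvdpl h (_ : coprimep c (p ^+ k.+1))) 1?coprimep_sym //.
apply: v_min.
have : (u *m horner_mx A h + v *m horner_mx A h)
    *m horner_mx A (p ^+ k.+1) = 0.
  by rewrite uvh0 mul0mx.
rewrite mulmxDl -!mulmxA !mulmxE -!rmorphM.
by rewrite (mulmx_horner_dvdp u_p) ?dvdp_mull // add0r.
Qed.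

Lemma exists_cyclic_vector :
  exists v : 'rV_n.+1, forall h, v *m horner_mx A h = 0 -> mu %| h.
Proof.
have [||v _ v_min] := @coprime_factor_vector mu 1; rewrite ?mulr1 ?coprimep1 //.
by exists v.
Qed.

(** When [mu] has full degree, the cyclic vector [v] makes every vector of the
    form [v * r(A)], so a matrix [B] commuting with [A] is determined by
    [v * B], hence equal to the polynomial in [A] that agrees with it on [v]. *)
Lemma comm_mx_horner_cyclic (B : 'M_n.+1) :
  size mu = n.+2 -> comm_mx B A -> exists h, B = horner_mx A h.
Proof.
move=> size_mu cBA; have [v v_min] := exists_cyclic_vector.
pose krylov (r : 'rV[K]_n.+1) : 'rV_n.+1 := v *m horner_mx A (rVpoly r).
have krylov_inj : injective krylov.
  move=> r1 r2 /eqP; rewrite -subr_eq0 -mulmxBr -rmorphB -raddfB.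
  move=> /eqP/v_min/dvdp_leq mu_le; apply/eqP; rewrite -subr_eq0.
  apply: contraTT isT => r0; have := mu_le; rewrite size_mu ltnNge size_poly.
  apply; apply: contra_neq r0 => r0.
  by rewrite -(rVpolyK (r1 - r2)) r0; apply/rowP=> i; rewrite !mxE coef0.
have [inv_krylov _ krylovK] := injF_bij krylov_inj.
exists (rVpoly (inv_krylov (v *m B))); set h := rVpoly _.
have vBh : v *m (B - horner_mx A h) = 0.
  by rewrite mulmxBr -[v *m horner_mx A h]/(krylov _) krylovK subrr.
apply/eqP; rewrite -subr_eq0; apply/eqP/row_matrixP=> i.
rewrite row0 rowE -[delta_mx 0 i]krylovK /krylov -mulmxA.
rewrite (_ : _ *m (_ - _) = (B - horner_mx A h) *m horner_mx A (rVpoly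
  (inv_krylov (delta_mx 0 i)))); first by rewrite mulmxA vBh mul0mx.
rewrite mulmxBr mulmxBl; congr (_ - _); first by rewrite (comm_mx_horner _ cBA).
by rewrite !mulmxE -!rmorphM mulrC.
Qed.

End CyclicVector.

Lemma mxminpoly_eq_char_poly (K : fieldType) n (A : 'M[K]_n.+1) :
  (mxminpoly A == char_poly A) = (size (mxminpoly A) == n.+2).
Proof.
apply/eqP/eqP=> [-> | size_mu]; first exact: size_char_poly.
apply/eqP; rewrite -eqp_monic ?mxminpoly_monic ?char_poly_monic //.
by rewrite -dvdp_size_eqp ?mxminpoly_dvd_char // size_mu size_char_poly.
Qed.

(** * Pairwise non-commuting sets from cyclic centralisers *)

Section CyclicCentralisers.

Variables (F : finFieldType) (n : nat).
Implicit Types g h x y : {'GL_n[F]}.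
Local Notation GL := ('GL_n[F])%g.

Lemma cyclic_mxE g : cyclic_mx g = (size (mxminpoly (GLval g)) == n.-1.+2).
Proof. by rewrite /cyclic_mx eq_sym mxminpoly_eq_char_poly. Qed.

Lemma commute_GLval x y : commute x y <-> comm_mx (GLval x) (GLval y).
Proof.
split=> [cxy | cxy]; first by rewrite /comm_mx !mulmxE -!GL_ME cxy.
by apply: val_inj; exact: cxy.
Qed.

Lemma commute_cyclic g x :
  cyclic_mx g -> commute g x -> exists p, GLval x = horner_mx (GLval g) p.
Proof.
rewrite cyclic_mxE => /eqP size_g cgx; apply: comm_mx_horner_cyclic => //.
by apply/commute_GLval/commute_sym.
Qed.

Lemma cyclic_cent_abelian g x y :
  cyclic_mx g -> commute g x -> commute g y -> commute x y.
Proof.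
move=> cyc_g /(commute_cyclic cyc_g)[p xE] /(commute_cyclic cyc_g)[r yE].
by apply/commute_GLval; rewrite /comm_mx xE yE !mulmxE -!rmorphM mulrC.
Qed.

Lemma cyclic_commute_cent g h :
  cyclic_mx g -> cyclic_mx h -> commute g h -> ('C_GL[g] = 'C_GL[h])%g.
Proof.
move=> cyc_g cyc_h cgh; congr (_ :&: _)%g; apply/setP=> x.
apply/cent1P/cent1P=> cx.
  exact: cyclic_cent_abelian cyc_g (commute_sym cx) cgh.
exact: cyclic_cent_abelian cyc_h (commute_sym cx) (commute_sym cgh).
Qed.

Lemma card_cyclic_centralisers_le_omega :
  (#|cyclic_centralisers F n| <= omega GL)%N.
Proof.
pose gen (C : {set {'GL_n[F]}}) : {'GL_n[F]} :=
  odflt 1%g [pick g | cyclic_mx g && ('C_GL[g]%g == C)].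
have genP C : C \in cyclic_centralisers F n ->
    cyclic_mx (gen C) /\ 'C_GL[gen C]%g = C.
  case/imsetP=> g; rewrite inE => /andP[_ cyc_g] ->; rewrite /gen.
  case: pickP => [h /andP[cyc_h /eqP] // | /(_ g)].
  by rewrite cyc_g eqxx.
rewrite -(card_in_imset (f := gen)) => [|C1 C2]; last first.
  by move=> /genP[_ defC1] /genP[_ defC2] eq12; rewrite -defC1 eq12 defC2.
apply: leq_bigmax_cond; rewrite subsetT.
apply/forall_inP=> _ /imsetP[C1 /genP[cyc1 defC1] ->].
apply/forall_inP=> _ /imsetP[C2 /genP[cyc2 defC2] ->].
apply/implyP; apply: contraNneq => c12; apply/eqP; congr gen.
by rewrite -defC1 -defC2; apply: cyclic_commute_cent.
Qed.

End CyclicCentralisers.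

(** * Every monic polynomial is a minimal polynomial *)

(** The first unit row vector is cyclic for the companion matrix. *)
Lemma exists_mxminpoly (K : fieldType) n (p : {poly K}) :
  p \is monic -> size p = n.+2 -> exists A : 'M[K]_n.+1, mxminpoly A = p.
Proof.
move=> mon_p size_p.
have [A [charA stepA]] : exists A : 'M[K]_n.+1, char_poly A = p /\
    forall i (lt_i : (i.+1 < n.+1)%N),
      delta_mx 0 (Ordinal (ltnW lt_i)) *m A
        = delta_mx 0 (Ordinal lt_i) :> 'rV_n.+1.
  (* [companionmx p] has dimension [(size p).-1], which is only provably
     [n.+1], so the dimension is generalised first. *)
  have: (size p).-1 = n.+1 by rewrite size_p.
  move: n.+1 => d <-; exists (companionmx p); split; first exact: companionmxK.
  by move=> i lt_i; rewrite mulmx_delta_companion.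
exists A; rewrite -charA; apply/eqP; rewrite mxminpoly_eq_char_poly.
rewrite eqn_leq -{1}(size_char_poly A).
rewrite dvdp_leq ?mxminpoly_dvd_char //; last first.
  by rewrite monic_neq0 ?char_poly_monic.
have powA i (lt_i : (i < n.+1)%N) :
    delta_mx 0 0 *m A ^+ i = delta_mx 0 (Ordinal lt_i) :> 'rV_n.+1.
  elim: i lt_i => [|i IHi] lt_i.
    by rewrite expr0 mulmx1; congr delta_mx; apply: val_inj.
  by rewrite exprSr mulmxA (IHi (ltnW lt_i)) stepA.
rewrite ltnNge; apply/negP=> size_mu.
have /(congr1 (fun B => delta_mx 0 0 *m B : 'rV_n.+1)) := mx_root_minpoly A.
rewrite mulmx0 -(poly_rV_K size_mu) horner_rVpoly.
rewrite [X in vec_mx X]mulmx_sum_row linear_sum mulmx_sumr.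
rewrite (eq_bigr (fun i => poly_rV (mxminpoly A) 0 i *: delta_mx 0 i)) => [|i _].
  rewrite -row_sum_delta => /(congr1 (@rVpoly _ _)).
  rewrite poly_rV_K // raddf0 => /eqP; apply/negP.
  by rewrite monic_neq0 ?mxminpoly_monic.
rewrite !linearZ /= rowK mxvecK powA.
by congr (_ *: delta_mx _ _); apply: val_inj.
Qed.

(** * Size of the centraliser of a cyclic matrix *)

Lemma mulmx_eigen_horner (K : fieldType) n (A : 'M[K]_n.+1) (v : 'rV_n.+1) a h :
  v *m A = a *: v -> v *m horner_mx A h = h.[a] *: v.
Proof.
move=> vA; elim/poly_ind: h => [|h c IHh].
  by rewrite rmorph0 mulmx0 horner0 scale0r.
rewrite rmorphD rmorphM /= horner_mx_X horner_mx_C mulmxDr mulmxA IHh.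
by rewrite -scalemxAl vA scalerA mul_mx_scalar hornerMXaddC scalerDl.
Qed.

Lemma unit_horner_mx_root (K : fieldType) n (A : 'M[K]_n.+1) a h :
  horner_mx A h \in unitmx -> root (mxminpoly A) a -> h.[a] != 0.
Proof.
rewrite -eigenvalue_root_min => unit_h /eigenvalueP[v vA v0].
apply: contra_neq v0 => ha0.
by rewrite -(mulmxK unit_h v) (mulmx_eigen_horner _ vA) ha0 scale0r mul0mx.
Qed.

Section RootSets.

Variable F : finFieldType.

(** The roots of [p] in the finite field [F], without multiplicity. *)
Definition rootset (p : {poly F}) : {set F} := [set a | root p a].

Lemma dvdp_prod_XsubC (S : {set F}) (p : {poly F}) :
  {in S, forall a, p.[a] = 0} -> \prod_(a in S) ('X - a%:P) %| p.
Proof.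
move=> rootS; rewrite -big_enum /=; apply: uniq_roots_dvdp.
  by apply/allP=> a; rewrite mem_enum => /rootS/eqP.
by rewrite uniq_rootsE enum_uniq.
Qed.

Lemma size_prod_XsubC_set (S : {set F}) :
  size (\prod_(a in S) ('X - a%:P)) = #|S|.+1.
Proof. by rewrite -big_enum size_prod_XsubC -cardE. Qed.

Lemma card_rootset (p : {poly F}) n :
  size p = n.+1 -> (#|rootset p| <= n)%N.
Proof.
move=> size_p; rewrite -ltnS -size_prod_XsubC_set -size_p dvdp_leq //.
  by rewrite -size_poly_gt0 size_p.
by apply: dvdp_prod_XsubC => a; rewrite inE => /rootP.
Qed.

End RootSets.

Section CardCentraliser.

Variables (F : finFieldType) (n : nat).

(** An element of [C] is [h(A)] with [size h <= n.+1]. Modulo the product [P] of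
    the [X - a] over the roots [a] of [mxminpoly A], [h] is determined by its
    values at these roots, which are nonzero since [h(A)] is invertible; the
    quotient by [P] has [n.+1 - #|roots|] free coefficients. *)
Lemma card_unit_centraliser (A : 'M[F]_n.+1) (C : {set 'M[F]_n.+1}) :
    size (mxminpoly A) = n.+2 ->
    {in C, forall B, B \in unitmx /\ comm_mx B A} ->
  let k := #|rootset (mxminpoly A)| in
  (#|C| <= #|F| ^ (n.+1 - k) * #|F|.-1 ^ k)%N.
Proof.
move=> size_mu CP; rewrite /=; set S := rootset (mxminpoly A).
pose P := \prod_(a in S) ('X - a%:P).
have P0 : P != 0 by rewrite -size_poly_gt0 size_prod_XsubC_set.
pose pol B := mx_inv_horner A B.
have polK B : B \in C -> horner_mx A (pol B) = B.
  case/CP=> _ cBA; rewrite mx_inv_hornerK //.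
  by have [h ->] := comm_mx_horner_cyclic size_mu cBA; rewrite horner_mx_mem.
have size_pol B : (size (pol B) <= n.+1)%N.
  rewrite (leq_trans (size_poly _ _)) //.
  by rewrite -ltnS -size_mxminpoly size_mu.
pose quo B : 'rV[F]_(n.+1 - #|S|) := poly_rV (pol B %/ P).
pose val B : {ffun F -> F} := [ffun a => if a \in S then (pol B).[a] else 0].
pose enc B := (quo B, val B).
have enc_inj : {in C &, injective enc}.
  move=> B1 B2 C1 C2 [eq_quo eq_val].
  rewrite -(polK B1) // -(polK B2) //; congr horner_mx.
  have size_quo B : (size (pol B %/ P)%R <= n.+1 - #|S|)%N.
    by rewrite size_divp // size_prod_XsubC_set leq_sub2r.
  rewrite (divp_eq (pol B1) P) (divp_eq (pol B2) P); congr (_ * _ + _).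
    by rewrite -(poly_rV_K (size_quo B1)) -/(quo B1) eq_quo poly_rV_K.
  apply/eqP; rewrite -subr_eq0 -modpN -modpD; apply/dvdp_prod_XsubC=> a Sa.
  have := congr1 (fun f : {ffun F -> F} => f a) eq_val.
  by rewrite !ffunE Sa hornerD hornerN => ->; rewrite subrr.
rewrite -(card_in_imset enc_inj).
pose V : {set {ffun F -> F}} := [set f in pffun_on 0 (mem S) (predC1 0)].
have cardV : #|V| = (#|F|.-1 ^ #|S|)%N.
  rewrite cardsE -(cardC1 (0 : F)).
  exact: (card_pffun_on 0 (mem S) (predC1 (0 : F))).
have -> : (#|F| ^ (n.+1 - #|S|) * #|F|.-1 ^ #|S|)%N =
    #|setX [set: 'rV[F]_(n.+1 - #|S|)] V|.
  by rewrite cardsX cardsT card_mx mul1n cardV.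
apply/subset_leq_card/subsetP=> _ /imsetP[B CB ->].
rewrite !inE /=; apply/pffun_onP; split.
  by apply/subsetP=> a; rewrite inE /= ffunE; case: ifP => //; rewrite eqxx.
move=> _ /imageP[a Sa ->]; rewrite ffunE Sa inE /=.
have [unitB _] := CP B CB; apply: (@unit_horner_mx_root _ _ A).
  by rewrite polK.
by move: Sa; rewrite inE.
Qed.

End CardCentraliser.

Lemma card_cyclic_cent (F : finFieldType) n (g : {'GL_n[F]}) :
  cyclic_mx g ->
  let k := #|rootset (mxminpoly (GLval g))| in
  (#|('C_('GL_n[F])[g])%g| <= #|F| ^ (n.-1.+1 - k) * #|F|.-1 ^ k)%N.
Proof.
rewrite cyclic_mxE => /eqP size_mu /=.
rewrite -(card_imset _ (val_inj : injective (@GLval n F))).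
apply: card_unit_centraliser => // _ /imsetP[x /setIP[_ /cent1P cxg] ->].
by split; [exact: GL_unitmx | exact: (proj1 (commute_GLval x g) cxg)].
Qed.

(** * Counting monic polynomials with nonzero constant term *)

Section MonicPolynomials.

Variable F : finFieldType.

(** The monic polynomial of degree [n] whose lower coefficients are the entries
    of [r]; row vectors thus serve as a finite type of monic polynomials. *)
Definition monic_rV n (r : 'rV[F]_n) : {poly F} := 'X^n + rVpoly r.

(** The monic polynomials of degree [n] with nonzero constant term. *)
Definition unit_monic n : {set 'rV[F]_n} := [set r | (monic_rV r).[0] != 0].

Lemma size_monic_rV n (r : 'rV_n) : size (monic_rV r) = n.+1.
Proof. by rewrite size_polyDl size_polyXn // ltnS size_poly. Qed.

Lemma monic_rV_monic n (r : 'rV_n) : monic_rV r \is monic.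
Proof.
rewrite monicE lead_coefDl ?lead_coefXn //.
by rewrite size_polyXn ltnS size_poly.
Qed.

Lemma monic_rVK n : cancel (@monic_rV n) (@poly_rV F n).
Proof.
move=> r; rewrite raddfD /= rVpolyK; apply/rowP=> i.
by rewrite !mxE coefXn ltn_eqF // add0r.
Qed.

Lemma poly_rV_monicK n (p : {poly F}) :
  p \is monic -> size p = n.+1 -> monic_rV (poly_rV p : 'rV_n) = p.
Proof.
move=> mon_p size_p; apply/polyP=> i; rewrite coefD coefXn coef_rVpoly.
case: insubP => [j lt_j <- | ]; first by rewrite mxE (ltn_eqF (ltn_ord j)) add0r.
rewrite -leqNgt addr0 leq_eqVlt => /predU1P[<- | lt_n].
  by rewrite eqxx -(monicP mon_p) lead_coefE size_p.
by rewrite gtn_eqF // nth_default // size_p.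
Qed.

Lemma card_unit_monic0 : (1 <= #|unit_monic 0|)%N.
Proof.
apply/card_gt0P; exists 0; rewrite inE /monic_rV raddf0 addr0 expr0 hornerC.
exact: oner_neq0.
Qed.

(** A polynomial outside [unit_monic] is determined by its [m] nonconstant lower
    coefficients. *)
Lemma card_unit_monicS m : (#|F| ^ m.+1 <= #|unit_monic m.+1| + #|F| ^ m)%N.
Proof.
have -> : (#|F| ^ m.+1 = #|{: 'rV[F]_m.+1}|)%N by rewrite card_mx mul1n.
have -> : (#|F| ^ m = #|{: 'rV[F]_m}|)%N by rewrite card_mx mul1n.
rewrite -(cardsC (unit_monic m.+1)) leq_add2l.
pose tl (r : 'rV[F]_m.+1) : 'rV[F]_m := col' 0 r.
apply: (@leq_card_in _ _ tl) => r1 r2; rewrite !inE !negbK.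
rewrite /monic_rV !hornerE !horner_coef0 !coef_rVpoly expr0n /= !add0r.
case: insubP => // i _ i0; rewrite (_ : i = 0); last exact: val_inj.
move=> /eqP r1_0 /eqP r2_0 /rowP eq_tl; apply/rowP=> j.
case: (unliftP 0 j) => [k -> | ->]; last by rewrite r1_0 r2_0.
by have := eq_tl k; rewrite !mxE.
Qed.

(** The map sending [(a, u)] to [(('X - a) u, a)], for [a != 0] and [u] in
    [unit_monic m], injects into the pairs of a polynomial and one of its
    roots. *)
Lemma sum_card_rootset m :
  (#|F|.-1 * #|unit_monic m|
     <= \sum_(r in unit_monic m.+1) #|rootset (monic_rV r)|)%N.
Proof.
pose E := [set u : 'rV[F]_m.+1 * F |
  (u.1 \in unit_monic m.+1) && (u.2 \in rootset (monic_rV u.1))].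
have -> : (\sum_(r in unit_monic m.+1) #|rootset (monic_rV r)| = #|E|)%N.
  rewrite -sum1_card; under eq_bigr do rewrite -sum1_card.
  by rewrite pair_big_dep /=; apply: eq_bigl => u; rewrite [RHS]inE.
rewrite -(cardC1 (0 : F)) -(cardsE (predC1 0)) -cardsX.
pose mul (u : F * 'rV[F]_m) : {poly F} := ('X - u.1%:P) * monic_rV u.2.
have mulK u : monic_rV (poly_rV (mul u) : 'rV_m.+1) = mul u.
  apply: poly_rV_monicK; first by rewrite rpredM ?monicXsubC ?monic_rV_monic.
  rewrite size_monicM ?monicXsubC ?monic_neq0 ?monic_rV_monic //.
  by rewrite size_XsubC size_monic_rV.
pose f (u : F * 'rV[F]_m) : 'rV[F]_m.+1 * F := (poly_rV (mul u), u.1).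
rewrite -(card_imset _ (_ : injective f)).
  apply/subset_leq_card/subsetP=> u /imsetP[[a r] + ->].
  rewrite !inE /= => /andP[a0 r0].
  rewrite !mulK /mul /= hornerM hornerXsubC sub0r mulf_neq0 ?oppr_eq0 //=.
  by rewrite rootM root_XsubC eqxx.
move=> [a1 r1] [a2 r2] [/(congr1 (@monic_rV _)) + eq_a].
rewrite !mulK /mul /= eq_a => /(mulfI (monic_neq0 (monicXsubC a2))) eq_r.
by congr pair; apply: (can_inj (@monic_rVK m)).
Qed.

End MonicPolynomials.

(** * The lower bound on the number of cyclic centralisers *)

Lemma bernoulli_ineq (R : numDomainType) (x : R) m :
  0 <= x -> 1 + x *+ m <= (1 + x) ^+ m.
Proof.
move=> x0; elim: m => [|m IHm]; first by rewrite mulr0n addr0 expr0.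
have x1 : 0 <= 1 + x by rewrite addr_ge0.
rewrite exprS (le_trans _ (ler_wpM2l x1 IHm)) //.
rewrite mulrDl mul1r mulrDr mulr1 mulrS [x + _ *+ _]addrC addrA lerD2l.
by rewrite lerDl mulr_ge0 ?mulrn_wge0.
Qed.

Lemma inv_sqr_ge (R : numFieldType) (c q n k : nat) :
    (1 < q)%N -> (0 < c)%N -> (k <= n)%N ->
    (c <= q ^ (n - k) * q.-1 ^ k)%N ->
  (q%:R ^+ n)^-2 * (1 + 2 * k%:R / q.-1%:R) <= c%:R^-2 :> R.
Proof.
move=> q_gt1 c_gt0 le_k_n le_c.
have q0 : 0 < q%:R :> R by rewrite ltr0n ltnW.
have t0 : 0 < q.-1%:R :> R by rewrite ltr0n -subn1 subn_gt0.
have c0 : 0 < c%:R :> R by rewrite ltr0n.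
set x : R := q.-1%:R^-1; have x0 : 0 <= x by rewrite invr_ge0 ltW.
have qE : q%:R = q.-1%:R * (1 + x) :> R.
  by rewrite mulrDr mulr1 mulfV ?gt_eqF // natr1 prednK // ltnW.
rewrite ler_pdivrMl ?exprn_gt0 // ler_pdivlMr ?exprn_gt0 //.
have -> : (q%:R ^+ n) ^+ 2 =
    (1 + x) ^+ (k * 2) * (q%:R ^+ (n - k) * q.-1%:R ^+ k) ^+ 2.
  have -> : q%:R ^+ n = q%:R ^+ (n - k) * (q.-1%:R ^+ k * (1 + x) ^+ k) :> R.
    by rewrite -exprMn -qE -exprD subnK.
  by rewrite exprM mulrA exprMn mulrC.
apply: ler_pM.
- by rewrite addr_ge0 // !mulr_ge0 ?ler0n.
- by rewrite exprn_ge0 // ltW.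
- apply: le_trans (bernoulli_ineq _ x0); rewrite lerD2l -[x *+ _]mulr_natl natrM.
  by rewrite [2 * _]mulrC.
rewrite ler_pXn2r ?nnegrE ?mulr_ge0 ?exprn_ge0 ?ler0n //.
by rewrite -!natrX -natrM ler_nat.
Qed.

Section Bound.

Variables (F : finFieldType) (n : nat).
Local Notation GL := ('GL_n[F])%g.
Local Notation d := n.-1.+1.
Local Notation q := #|F|.

Lemma exists_GL_mxminpoly (r : 'rV[F]_d) : r \in unit_monic F d ->
  exists g : {'GL_n[F]}, mxminpoly (GLval g) = monic_rV r.
Proof.
rewrite inE => r0; have size_r := size_monic_rV r.
have [A muA] := exists_mxminpoly (monic_rV_monic r) size_r.
have charA : char_poly A = monic_rV r.
  by rewrite -muA; apply/esym/eqP; rewrite mxminpoly_eq_char_poly muA size_r.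
have unitA : A \is a GRing.unit.
  apply: contraNT r0 => /negPf; rewrite -[_ \in _]/(A \in unitmx) unitmxE unitfE.
  move=> /negbFE/eqP detA.
  by rewrite -charA horner_coef0 char_poly_det detA mulr0.
by exists (FinRing.Unit unitA).
Qed.

Lemma mxminpoly_GL_conj (x y : {'GL_n[F]}) :
  mxminpoly (GLval (x ^ y)%g) = mxminpoly (GLval x).
Proof.
apply: (simmx_minpoly (GL_unitmx y)); apply/(simmxP (GL_unitmx y)).
by rewrite !mulmxE -!GL_ME -conjgC.
Qed.

(** The weight [1 / |C(g)|] of a group element. *)
Definition inv_cent (g : {'GL_n[F]}) : rat := (#|('C_GL[g])%g|%:R)^-1.

Lemma inv_cent_class (g : {'GL_n[F]}) :
  inv_cent g = #|(g ^: GL)%g|%:R / #|GL|%:R.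
Proof.
rewrite /inv_cent -index_cent1 -(Lagrange (subsetIl GL 'C[g]%g)) natrM.
by rewrite invfM mulrCA mulfV ?mulr1 // pnatr_eq0 -lt0n indexg_gt0.
Qed.

Lemma inv_cent_ge0 g : 0 <= inv_cent g.
Proof. by rewrite invr_ge0 ler0n. Qed.

(** The elements with a given centraliser [C] lie in [C], so their weights add
    up to at most one. *)
Lemma sum_inv_cent_le :
  \sum_(g : {'GL_n[F]} | cyclic_mx g) inv_cent g
    <= #|cyclic_centralisers F n|%:R.
Proof.
rewrite (partition_big (fun g => 'C_GL[g]%g)
  (mem (cyclic_centralisers F n))) /=; last first.
  by move=> g cyc_g; apply/imsetP; exists g; rewrite // !inE.
rewrite -sum1_card natr_sum; apply: ler_sum => C /imsetP[g0 _ defC].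
have C0 : 0 < #|C|%:R :> rat.
  by rewrite ltr0n; apply/card_gt0P; exists 1%g; rewrite defC group1.
rewrite (eq_bigr (fun=> #|C|%:R^-1)) => [|g /andP[_ /eqP <-] //].
rewrite sumr_const -[_^-1 *+ _]mulr_natl ler_pdivrMr // mul1r ler_nat.
apply/subset_leq_card/subsetP=> g; rewrite unfold_in => /andP[_ /eqP <-].
by rewrite inE in_setT cent1id.
Qed.

(** The right hand side contains the conjugacy class of [g0], whose elements
    number [|GL| / |C(g0)|] and all have the weight of [g0]. *)
Lemma sum_inv_cent_mxminpoly (g0 : {'GL_n[F]}) :
  #|GL|%:R * inv_cent g0 ^+ 2 <=
  \sum_(g : {'GL_n[F]} | mxminpoly (GLval g) == mxminpoly (GLval g0))
     inv_cent g.
Proof.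
rewrite (bigID (mem (g0 ^: GL)%g)) /=.
apply: ler_wpDr; first by apply: sumr_ge0 => g _; exact: inv_cent_ge0.
rewrite (eq_bigl (mem (g0 ^: GL)%g)) => [|g]; last first.
  apply: andb_idl => /imsetP[y _ ->]; apply/eqP.
  exact: mxminpoly_GL_conj.
rewrite (eq_bigr (fun=> inv_cent g0)) => [|g /class_eqP eq_g]; last first.
  by rewrite !inv_cent_class eq_g.
rewrite sumr_const -[inv_cent g0 *+ _]mulr_natl expr2 mulrA {1}inv_cent_class.
by rewrite mulrCA mulfV ?mulr1 // pnatr_eq0 -lt0n cardG_gt0.
Qed.

Lemma inv_cent_sqr_ge (g : {'GL_n[F]}) (r : 'rV[F]_d) :
    mxminpoly (GLval g) = monic_rV r ->
  (q%:R ^+ d)^-2 * (1 + 2 * #|rootset (monic_rV r)|%:R / q.-1%:R)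
    <= inv_cent g ^+ 2.
Proof.
move=> mu_g; have size_mu : size (mxminpoly (GLval g)) = d.+1.
  by rewrite mu_g size_monic_rV.
rewrite /inv_cent exprVn -mu_g; apply: inv_sqr_ge.
- exact: card_finNzRing_gt1.
- exact: cardG_gt0.
- exact: card_rootset.
by apply: card_cyclic_cent; rewrite cyclic_mxE size_mu.
Qed.

Lemma sum_unit_monic_ge :
  q%:R ^+ d <=
  \sum_(r in unit_monic F d)
     (1 + 2 * #|rootset (monic_rV r)|%:R / q.-1%:R) :> rat.
Proof.
have q_gt1 : (1 < q)%N by exact: card_finNzRing_gt1.
have t0 : 0 < q.-1%:R :> rat by rewrite ltr0n -subn1 subn_gt0.
rewrite big_split /= sumr_const -mulr_suml -mulr_sumr -natr_sum.
apply: (@le_trans _ _ (#|unit_monic F d|%:R + 2 * #|unit_monic F n.-1|%:R)).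
  rewrite -natrX -natrM -natrD ler_nat.
  (* When [n.-1 = 0] there is no lower power of [q] to compare with: the deficit
     [q ^ 0] is covered by [unit_monic F 0] being nonempty. *)
  have := card_unit_monicS F n.-1; case: n.-1 => [|m].
    have := card_unit_monic0 F; rewrite expn0 => le1 le2.
    apply: leq_trans le2 _; rewrite leq_add2l.
    by rewrite (leq_trans le1) // leq_pmull.
  move=> le2; apply: leq_trans le2 _; rewrite leq_add2l.
  have := card_unit_monicS F m; move: #|unit_monic F m.+1| => u le1.
  have : (2 * q ^ m <= q ^ m.+1)%N by rewrite expnS leq_mul2r q_gt1 orbT.
  by rewrite !mul2n -!addnn; move: le1; lia.
rewrite lerD2l -mulrA ler_pM2l // ler_pdivlMr // -natrM ler_nat mulnC.
exact: sum_card_rootset.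
Qed.

(** The cyclic elements are sorted by the row vector of their minimal
    polynomial. *)
Lemma card_cyclic_centralisers_ge :
  (q%:R ^+ d)^-1 <= #|cyclic_centralisers F n|%:R / #|GL|%:R :> rat.
Proof.
have GL0 : 0 < #|GL|%:R :> rat by rewrite ltr0n cardG_gt0.
have q0 : 0 < q%:R :> rat by rewrite ltr0n ltnW ?card_finNzRing_gt1.
have step1 : \sum_(r in unit_monic F d) #|GL|%:R *
    ((q%:R ^+ d)^-2 * (1 + 2 * #|rootset (monic_rV r)|%:R / q.-1%:R))
    <= #|cyclic_centralisers F n|%:R :> rat.
  apply: le_trans sum_inv_cent_le.
  pose rVmu (g : {'GL_n[F]}) : 'rV[F]_d := poly_rV (mxminpoly (GLval g)).
  rewrite [leRHS](partition_big rVmu xpredT) //=.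
  rewrite [leRHS](bigID (mem (unit_monic F d))) /=.
  rewrite ler_wpDr ?sumr_ge0 // => [r _|].
    by apply: sumr_ge0 => g _; exact: inv_cent_ge0.
  apply: ler_sum => r /exists_GL_mxminpoly[g0 mu_g0].
  apply: le_trans (ler_wpM2l (ltW GL0) (inv_cent_sqr_ge mu_g0)) _.
  apply: le_trans (sum_inv_cent_mxminpoly g0) _.
  rewrite le_eqVlt; apply/orP; left; apply/eqP; apply: eq_bigl => g.
  rewrite cyclic_mxE mu_g0; apply/eqP/andP=> [mu_g | [/eqP size_g /eqP <-]].
    by rewrite mu_g size_monic_rV eqxx /rVmu mu_g monic_rVK.
  by rewrite poly_rV_monicK // mxminpoly_monic.
rewrite ler_pdivlMr //; apply: le_trans step1.
rewrite -mulr_sumr -mulr_sumr mulrC ler_pM2l //.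
rewrite ler_pdivlMl ?exprn_gt0 // expr2 mulfK ?expf_neq0 ?gt_eqF //.
exact: sum_unit_monic_ge.
Qed.

End Bound.

Theorem theorem1p4 (F : finFieldType) (q n : nat)
    (card_F : #|F| = q) (n_ge1 : (1 <= n)%N) :
  let qQ : rat := q%:R in
  let GL_card : rat := #|('GL_n[F])%g|%:R in
  let N : rat := #|cyclic_centralisers F n|%:R in
  (omega ('GL_n[F])%g)%:R / GL_card >= N / GL_card
  /\ N / GL_card >=
       qQ ^- n * (1 - qQ ^- 3 - qQ ^- 5 + qQ ^- 6 - qQ ^- n).
Proof.
move=> qQ GL_card N; split.
  rewrite ler_wpM2r ?invr_ge0 ?ler0n // ler_nat.
  exact: card_cyclic_centralisers_le_omega.
apply: le_trans (card_cyclic_centralisers_ge F n).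
have q0 : 0 < qQ by rewrite ltr0n -card_F ltnW ?card_finNzRing_gt1.
have q_ge1 : 1 <= qQ by rewrite ler1n -card_F ltnW ?card_finNzRing_gt1.
rewrite card_F prednK // -/qQ ler_piMr ?invr_ge0 ?exprn_ge0 ?(ltW q0) //.
have q3 : 0 <= qQ ^- 3 by rewrite invr_ge0 exprn_ge0 ?ltW.
have q5 : 0 <= qQ ^- 5 by rewrite invr_ge0 exprn_ge0 ?ltW.
have qn : 0 <= qQ ^- n by rewrite invr_ge0 exprn_ge0 ?ltW.
have q6 : qQ ^- 6 <= qQ ^- 5.
  by rewrite lef_pV2 ?posrE ?exprn_gt0 // ler_weXn2l.
move: (qQ ^- 3) (qQ ^- 5) (qQ ^- 6) (qQ ^- n) q3 q5 qn q6 => a b c e.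
lra.
Qed.
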